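(* Suppose that $f\in AC^1(\mathcal S_{a,b,c},\mathbb R_n)$ is such that for all $\mathcal I\in\mathbb S$ the maps $u\mapsto(\mathbf I_{a^+}^{1-\alpha,g}f)(u+\mathcal I s)$, $u\in[a,b]$, and $v\mapsto(\mathbf I_{0^+}^{1-\beta,h}f)(r+\mathcal I v)$, $v\in[0,c]$, are of class $C^1$. Define $$\mathcal H(f)(u+\mathcal I v,r,s):=(\mathbf I_{a^+}^{1-\alpha,g}f)(u+\mathcal I s)+(\mathbf I_{0^+}^{1-\beta,h}f)(r+\mathcal I v).$$ Then $$\left({}_CD_{a^+,0^+}^{(\alpha,\beta),(g,h)}\mathcal H(f)\right)(u+\mathcal I v,r,s)=\mathcal H\left[({}_{RL}D_{a^+,0^+}^{(\alpha,\beta),(g,h)}f)(u+\mathcal I v,r,s)\right]$$ $$\qquad-\mathbf I_{0^+}^{1-\beta,h}[1]\,({}_{RL}D_{a^+}^{\alpha,g}f)(u+\mathcal I s)-\mathbf I_{a^+}^{1-\alpha,g}[1]\,\mathcal I\,({}_{RL}D_{0^+}^{\beta,h}f)(r+\mathcal I v)$$ for all $u+\mathcal I v\in\mathcal S_{a,b,c}$ and $\mathcal I\in\mathbb S$.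
   Context: $\mathbb R_n$ is the real Clifford algebra generated by $e_1,\dots,e_n$ with $e_ie_j+e_je_i=-2\delta_{ij}$; $\mathbb R^{n+1}$ is identified with the paravectors $x_0+\sum_j x_je_j$; $\mathbb S=\{\sum_j x_je_j:\sum_j x_j^2=1\}$. Let $a<b$, $c>0$ be real, $\alpha,\beta\in(0,1)$, and fix $r\in[a,b]$, $s\in[0,c]$. $\mathcal S_{a,b,c}=\{u+\mathcal I v\in\mathbb R^{n+1} : u\in[a,b],\ v\in[0,c],\ \mathcal I\in\mathbb S\}$. $AC^1(\mathcal S_{a,b,c},\mathbb R_n)$ is the set of continuous $f:\mathcal S_{a,b,c}\to\mathbb R_n$ such that for every $\mathcal I\in\mathbb S$ the maps $u\mapsto f(u+\mathcal I s)$ on $[a,b]$ and $v\mapsto f(r+\mathcal I v)$ on $[0,c]$ are absolutely continuous. Let $\lambda\in\mathbb R$ and let $g\in C^2([a,b],\mathbb R)$, $h\in C^2([0,c],\mathbb R)$ be restrictions of $C^2(\mathbb R,\mathbb R)$ solutions of $y''+2\lambda y'=0$, with $g'>0$ on $[a,b]$ and $h'>0$ on $[0,c]$. For $\mathbb R_n$-valued $\varphi$ on $[a,b]$, respectively $\psi$ on $[0,c]$, $$\mathbf I_{a^+}^{1-\alpha,g}[\varphi](u)=\frac1{\Gamma(1-\alpha)}\int_a^u\frac{\varphi(\tau)}{(g(u)-g(\tau))^\alpha}g'(\tau)\,d\tau,\qquad \mathbf I_{0^+}^{1-\beta,h}[\psi](v)=\frac1{\Gamma(1-\beta)}\int_0^v\frac{\psi(\tau)}{(h(v)-h(\tau))^\beta}h'(\tau)\,d\tau,$$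 with value $0$ at $u=a$, respectively $v=0$. $(\mathbf I_{a^+}^{1-\alpha,g}f)(u+\mathcal I s)$ and $(\mathbf I_{0^+}^{1-\beta,h}f)(r+\mathcal I v)$ are these integrals for $\varphi(\tau)=f(\tau+\mathcal I s)$ and $\psi(\tau)=f(r+\mathcal I\tau)$. $\mathbf I_{a^+}^{1-\alpha,g}[1]$ and $\mathbf I_{0^+}^{1-\beta,h}[1]$ are the fractional integrals of the constant function $1$, evaluated at $u$ and at $v$ respectively. Riemann-Liouville derivatives: $$({}_{RL}D_{a^+}^{\alpha,g}f)(u+\mathcal I s)=\frac1{g'(u)}\frac{\partial}{\partial u}(\mathbf I_{a^+}^{1-\alpha,g}f)(u+\mathcal I s),\qquad({}_{RL}D_{0^+}^{\beta,h}f)(r+\mathcal I v)=\frac1{h'(v)}\frac{\partial}{\partial v}(\mathbf I_{0^+}^{1-\beta,h}f)(r+\mathcal I v),$$ $$({}_{RL}D_{a^+,0^+}^{(\alpha,\beta),(g,h)}f)(u+\mathcal I v,r,s)=({}_{RL}D_{a^+}^{\alpha,g}f)(u+\mathcal I s)+\mathcal I\,({}_{RL}D_{0^+}^{\beta,h}f)(r+\mathcal I v).$$ For a function $G(u,v)$ of the two real variables $u,v$ (for fixed $\mathcal I,r,s$), $\mathcal H[G](u,v)$ means $\mathbf I_{a^+}^{1-\alpha,g}[G(\cdot,v)](u)+\mathbf I_{0^+}^{1-\beta,h}[G(u,\cdot)](v)$. The Caputo operator applied to $\mathcal H(f)$ is $$\left({}_CD_{a^+,0^+}^{(\alpha,\beta),(g,h)}\mathcal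 H(f)\right)(u+\mathcal I v,r,s)=\mathbf I_{a^+}^{1-\alpha,g}\left[\frac1{g'}\frac{\partial}{\partial u}\mathcal H(f)\right]+\mathcal I\,\mathbf I_{0^+}^{1-\beta,h}\left[\frac1{h'}\frac{\partial}{\partial v}\mathcal H(f)\right],$$ where the first integral is taken in the variable $u$ and the second in the variable $v$. *)

(* Defs.v *)
From HB Require Import structures.
From mathcomp Require Import all_boot all_order all_algebra.
From mathcomp Require Import all_classical all_reals all_analysis.

Set Implicit Arguments.
Unset Strict Implicit.
Unset Printing Implicit Defensive.

Import Order.TTheory GRing.Theory Num.Theory.
Import numFieldNormedType.Exports.

Local Open Scope classical_set_scope.
Local Open Scope ring_scope.

(* The real Clifford algebra on n generators with e_i e_j + e_j e_i =
   -2 delta_ij, as the free module on the blades e_A = e_{i1} ... e_{ik}, where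
   A = {i1 < ... < ik}; rows are indexed by subsets through enum_rank, and the
   algebra carries the (sup-)normed module structure of rows. *)
Definition clifford (R : realType) (n : nat) : Type :=
  'rV[R]_#|{set 'I_n}|.

HB.instance Definition _ (R : realType) (n : nat) :=
  NormedModule.copy (clifford R n) 'rV[R]_#|{set 'I_n}|.

Definition coef (R : realType) (n : nat) (A : {set 'I_n}) (x : clifford R n)
    : R :=
  (x : 'rV[R]_#|{set 'I_n}|) ord0 (enum_rank A).

Definition blade (R : realType) (n : nat) (A : {set 'I_n}) : clifford R n :=
  (delta_mx ord0 (enum_rank A) : 'rV[R]_#|{set 'I_n}|).

Arguments blade R {n} A.

Definition symdiff (n : nat) (A B : {set 'I_n}) : {set 'I_n} :=
  ((A :\: B) :|: (B :\: A))%SET.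

(* e_A e_B = (-1)^N e_{A symdiff B}, where N counts the pairs (i, j) in A x B
   with j <= i: the transpositions needed to sort (j < i) together with the
   squares e_i^2 = -1 (j = i). *)
Definition inv_count (n : nat) (A B : {set 'I_n}) : nat :=
  \sum_(i in A) \sum_(j in B) (j <= i)%N.

Definition clifford_mul (R : realType) (n : nat) (x y : clifford R n)
    : clifford R n :=
  \sum_(A : {set 'I_n}) \sum_(B : {set 'I_n})
    ((-1) ^+ inv_count A B * coef A x * coef B y) *: blade R (symdiff A B).

Lemma coefD (R : realType) (n : nat) (A : {set 'I_n}) (x y : clifford R n) :
  coef A (x + y) = coef A x + coef A y.
Proof. by rewrite /coef mxE. Qed.

Lemma coefZ (R : realType) (n : nat) (A : {set 'I_n}) (k : R)
  (x : clifford R n) : coef A (k *: x) = k * coef A x.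
Proof. by rewrite /coef mxE. Qed.

Lemma coef_blade (R : realType) (n : nat) (A B : {set 'I_n}) :
  coef A (blade R B) = (A == B)%:R.
Proof. by rewrite /coef /blade mxE eqxx (inj_eq enum_rank_inj). Qed.

Lemma coef_sum (R : realType) (n : nat) (A : {set 'I_n}) (I : Type)
  (s : seq I) (F : I -> clifford R n) :
  coef A (\sum_(i <- s) F i) = \sum_(i <- s) coef A (F i).
Proof.
elim: s => [|i s IHs]; first by rewrite !big_nil /coef mxE.
by rewrite !big_cons coefD IHs.
Qed.

Lemma coefP (R : realType) (n : nat) (x y : clifford R n) :
  (forall A, coef A x = coef A y) -> x = y.
Proof.
move=> xy; apply/rowP => k.
by have := xy (enum_val k); rewrite /coef enum_valK.
Qed.

Lemma clifford_decomp (R : realType) (n : nat) (x : clifford R n) :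
  x = \sum_(A : {set 'I_n}) coef A x *: blade R A.
Proof.
apply: coefP => B; rewrite coef_sum (bigD1 B) //= big1 => [|A AB].
  by rewrite coefZ coef_blade eqxx mulr1 addr0.
by rewrite coefZ coef_blade eq_sym (negbTE AB) mulr0.
Qed.

Lemma clifford_mulDl (R : realType) (n : nat) :
  left_distributive (@clifford_mul R n) +%R.
Proof.
move=> x y z; rewrite /clifford_mul -big_split; apply: eq_bigr => A _ /=.
rewrite -big_split; apply: eq_bigr => B _ /=.
by rewrite -scalerDl coefD mulrDr mulrDl.
Qed.

Lemma clifford_mulDr (R : realType) (n : nat) :
  right_distributive (@clifford_mul R n) +%R.
Proof.
move=> x y z; rewrite /clifford_mul -big_split; apply: eq_bigr => A _ /=.
rewrite -big_split; apply: eq_bigr => B _ /=.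
by rewrite -scalerDl coefD mulrDr.
Qed.

Lemma clifford_scalerAl (R : realType) (n : nat) (k : R) (x y : clifford R n) :
  k *: clifford_mul x y = clifford_mul (k *: x) y.
Proof.
rewrite /clifford_mul scaler_sumr; apply: eq_bigr => A _.
rewrite scaler_sumr; apply: eq_bigr => B _.
by rewrite scalerA coefZ !mulrA [_ * k]mulrC.
Qed.

Lemma clifford_scalerAr (R : realType) (n : nat) (k : R) (x y : clifford R n) :
  k *: clifford_mul x y = clifford_mul x (k *: y).
Proof.
rewrite /clifford_mul scaler_sumr; apply: eq_bigr => A _.
rewrite scaler_sumr; apply: eq_bigr => B _.
by rewrite scalerA coefZ !mulrA [_ * k]mulrC !mulrA.
Qed.

Lemma clifford_mul_blade (R : realType) (n : nat) (A B : {set 'I_n}) :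
  clifford_mul (blade R A) (blade R B) =
  (-1) ^+ inv_count A B *: blade R (symdiff A B).
Proof.
rewrite /clifford_mul (bigD1 A) //= [X in _ + X]big1 ?addr0; last first.
  move=> C CA; apply: big1 => D _.
  by rewrite coef_blade (negbTE CA) mulr0 mul0r scale0r.
rewrite (bigD1 B) //= big1 ?addr0 => [|D DB].
  by rewrite !coef_blade !eqxx !mulr1.
by rewrite [coef D _]coef_blade (negbTE DB) mulr0 scale0r.
Qed.

Lemma in_symdiff (n : nat) (A B : {set 'I_n}) (i : 'I_n) :
  (i \in symdiff A B) = (i \in A) (+) (i \in B).
Proof. by rewrite !inE; case: (i \in A); case: (i \in B). Qed.

Lemma symdiffA (n : nat) : associative (@symdiff n).
Proof. by move=> A B C; apply/setP => i; rewrite !in_symdiff addbA. Qed.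

Lemma sign_sum_symdiff (R : realType) (n : nat) (A B : {set 'I_n})
  (F : 'I_n -> nat) :
  (-1) ^+ (\sum_(i in symdiff A B) F i) =
  (-1) ^+ (\sum_(i in A) F i) * (-1) ^+ (\sum_(i in B) F i) :> R.
Proof.
rewrite !expr_sum big_mkcond [X in _ = X * _]big_mkcond.
rewrite [X in _ = _ * X]big_mkcond -big_split; apply: eq_bigr => i _ /=.
rewrite in_symdiff; case: (i \in A); case: (i \in B); rewrite ?mulr1 ?mul1r //=.
by rewrite -exprMn mulrNN mulr1 expr1n.
Qed.

Lemma sign_inv_countDl (R : realType) (n : nat) (A B C : {set 'I_n}) :
  (-1) ^+ inv_count (symdiff A B) C =
  (-1) ^+ inv_count A C * (-1) ^+ inv_count B C :> R.
Proof. exact: sign_sum_symdiff. Qed.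

Lemma sign_inv_countDr (R : realType) (n : nat) (A B C : {set 'I_n}) :
  (-1) ^+ inv_count A (symdiff B C) =
  (-1) ^+ inv_count A B * (-1) ^+ inv_count A C :> R.
Proof.
rewrite /inv_count exchange_big [in X in _ = X * _]exchange_big.
by rewrite [in X in _ = _ * X]exchange_big; exact: sign_sum_symdiff.
Qed.

Lemma clifford_mul_suml (R : realType) (n : nat) (I : Type) (s : seq I)
  (F : I -> clifford R n) (y : clifford R n) :
  clifford_mul (\sum_(i <- s) F i) y = \sum_(i <- s) clifford_mul (F i) y.
Proof.
elim: s => [|i s IHs].
  rewrite !big_nil -[X in clifford_mul X _](scale0r 0).
  by rewrite -clifford_scalerAl scale0r.
by rewrite !big_cons clifford_mulDl IHs.
Qed.

Lemma clifford_mul_sumr (R : realType) (n : nat) (I : Type) (s : seq I)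
  (F : I -> clifford R n) (x : clifford R n) :
  clifford_mul x (\sum_(i <- s) F i) = \sum_(i <- s) clifford_mul x (F i).
Proof.
elim: s => [|i s IHs].
  rewrite !big_nil -[X in clifford_mul _ X](scale0r 0).
  by rewrite -clifford_scalerAr scale0r.
by rewrite !big_cons clifford_mulDr IHs.
Qed.

Lemma clifford_mul_bladeA (R : realType) (n : nat) (A B C : {set 'I_n}) :
  clifford_mul (blade R A) (clifford_mul (blade R B) (blade R C)) =
  clifford_mul (clifford_mul (blade R A) (blade R B)) (blade R C).
Proof.
rewrite !clifford_mul_blade -clifford_scalerAr -clifford_scalerAl.
rewrite !clifford_mul_blade !scalerA symdiffA; congr (_ *: blade R _).
by rewrite sign_inv_countDl sign_inv_countDr [LHS]mulrC -!mulrA.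
Qed.

Lemma clifford_mulA (R : realType) (n : nat) : associative (@clifford_mul R n).
Proof.
have sl := @clifford_mul_suml R n {set 'I_n} (index_enum {set 'I_n}).
have sr := @clifford_mul_sumr R n {set 'I_n} (index_enum {set 'I_n}).
move: (@clifford_mul_bladeA R n) (@clifford_scalerAl R n) sl sr.
move: (@clifford_scalerAr R n).
set m := @clifford_mul R n; move: m => m mZr mA mZl sl sr x y z.
rewrite [x]clifford_decomp !sl; apply: eq_bigr => A _; rewrite -!mZl.
congr (@GRing.scale R (clifford R n) _ _).
rewrite [y]clifford_decomp sl !sr sl; apply: eq_bigr => B _.
rewrite -!(mZl, mZr); congr (@GRing.scale R (clifford R n) _ _).
rewrite [z]clifford_decomp !sr; apply: eq_bigr => C _; rewrite -!mZr.
by congr (@GRing.scale R (clifford R n) _ _); exact: mA.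
Qed.

Lemma clifford_mul1l (R : realType) (n : nat) :
  left_id (blade R finset.set0) (@clifford_mul R n).
Proof.
move=> x; rewrite [x]clifford_decomp clifford_mul_sumr; apply: eq_bigr => A _.
rewrite -clifford_scalerAr clifford_mul_blade /inv_count big_set0 scale1r.
by congr (_ *: blade R _); apply/setP => i; rewrite in_symdiff inE.
Qed.

Lemma clifford_mul1r (R : realType) (n : nat) :
  right_id (blade R finset.set0) (@clifford_mul R n).
Proof.
move=> x; rewrite [x]clifford_decomp clifford_mul_suml; apply: eq_bigr => A _.
rewrite -clifford_scalerAl clifford_mul_blade /inv_count exchange_big big_set0.
rewrite scale1r; congr (_ *: blade R _).
by apply/setP => i; rewrite in_symdiff inE addbF.
Qed.

Lemma clifford_1_neq0 (R : realType) (n : nat) :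
  blade R (finset.set0 : {set 'I_n}) != 0.
Proof.
apply/eqP => /(congr1 (coef finset.set0)) /eqP.
by rewrite coef_blade eqxx /coef mxE oner_eq0.
Qed.

HB.instance Definition _ (R : realType) (n : nat) :=
  GRing.Zmodule_isNzRing.Build (clifford R n)
    (@clifford_mulA R n) (@clifford_mul1l R n) (@clifford_mul1r R n)
    (@clifford_mulDl R n) (@clifford_mulDr R n) (@clifford_1_neq0 R n).

HB.instance Definition _ (R : realType) (n : nat) :=
  GRing.Lmodule_isLalgebra.Build R (clifford R n) (@clifford_scalerAl R n).

HB.instance Definition _ (R : realType) (n : nat) :=
  GRing.Lalgebra_isAlgebra.Build R (clifford R n) (@clifford_scalerAr R n).

Definition gen (R : realType) (n : nat) (i : 'I_n) : clifford R n :=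
  blade R [set i]%SET.

Arguments gen R {n} i.

Lemma gen_anticomm (R : realType) (n : nat) (i j : 'I_n) :
  gen R i * gen R j + gen R j * gen R i = (- 2 * (i == j)%:R) *: 1.
Proof.
have mulE (x y : clifford R n) : x * y = clifford_mul x y by [].
rewrite !mulE !clifford_mul_blade /inv_count !big_set1.
case: (eqVneq i j) => [<-|ij].
  rewrite leqnn -scalerDl expr1 mulr1 -opprD; congr (_ *: blade R _).
  by apply/setP => k; rewrite in_symdiff addbb inE.
rewrite mulr0 scale0r.
have -> : symdiff [set j] [set i] = symdiff [set i] [set j].
  by rewrite /symdiff finset.setUC.
rewrite -scalerDl; have [ltij|ltji|/val_inj eij] := ltngtP i j.
- by rewrite expr0 expr1 subrr scale0r.
- by rewrite expr0 expr1 addNr scale0r.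
- by rewrite eij eqxx in ij.
Qed.

Definition sphere (R : realType) (n : nat) : set (clifford R n) :=
  [set \sum_(j < n) x j *: gen R j | x in
    [set x : 'I_n -> R | \sum_(j < n) x j ^+ 2 = 1]].

Arguments sphere R n : clear implicits.

Definition slice_point (R : realType) (n : nat) (I : clifford R n) (u v : R)
    : clifford R n :=
  u%:A + v *: I.

Definition slice_domain (R : realType) (n : nat) (a b c : R)
    : set (clifford R n) :=
  [set p | exists u v I, [/\ u \in `[a, b], v \in `[0, c], sphere R n I &
    p = slice_point I u v]].

Definition abs_continuous (R : realType) (V : normedModType R) (a b : R)
    (F : R -> V) : Prop :=
  forall e : R, 0 < e -> exists2 d : R, 0 < d &
    forall (m : nat) (x y : 'I_m -> R),
      (forall k, [/\ a <= x k, x k <= y k & y k <= b]) ->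
      trivIset setT (fun k => `]x k, y k[%classic) ->
      \sum_(k < m) (y k - x k) < d ->
      \sum_(k < m) `|F (y k) - F (x k)| < e.

(* Points of R^(n+1) are the paravectors of the algebra, so a function on the
   slice domain is given by a total function on the algebra, of which only the
   restriction to slice_domain a b c matters. *)
Definition AC1 (R : realType) (n : nat) (a b c r s : R)
    (f : clifford R n -> clifford R n) : Prop :=
  {within slice_domain a b c, continuous f} /\
  forall I, sphere R n I ->
    abs_continuous a b (fun u => f (slice_point I u s)) /\
    abs_continuous 0 c (fun v => f (slice_point I r v)).

(* Derivative of a function defined on a set D: one-sided at the end points
   when D is a closed interval. *)
Definition diff_quot (R : realType) (V : normedModType R) (F : R -> V)
    (x t : R) : V :=
  (t - x)^-1 *: (F t - F x).

Definition derive_within (R : realType) (V : normedModType R) (D : set R)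
    (F : R -> V) (x : R) : V :=
  lim (diff_quot F x @ within D x^').

Definition class_C1_within (R : realType) (V : normedModType R) (D : set R)
    (F : R -> V) : Prop :=
  (forall x, D x -> cvg (diff_quot F x @ within D x^')) /\
  {within D, continuous (derive_within D F)}.

Definition class_C2 (R : realType) (y : R -> R) : Prop :=
  [/\ forall x, derivable y x 1, forall x, derivable (derive1 y) x 1 &
      continuous (derive1 (derive1 y))].

Definition ode_solution (R : realType) (l : R) (y : R -> R) : Prop :=
  class_C2 y /\ forall x, derive1 (derive1 y) x + 2 * l * derive1 y x = 0.

Definition Gamma (R : realType) (x : R) : R :=
  \int[@lebesgue_measure R]_(t in `]0, +oo[) (t `^ (x - 1) * expR (- t)).

Definition cliff_integral (R : realType) (n : nat) (D : set R)
    (F : R -> clifford R n) : clifford R n :=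
  \sum_(A : {set 'I_n})
    (\int[@lebesgue_measure R]_(t in D) coef A (F t)) *: blade R A.

(* The fractional integral of order 1 - k with base point x0, with respect to
   w; its value at x0 is an integral over a null set, hence 0. *)
Definition frac_int (R : realType) (n : nat) (x0 k : R) (w : R -> R)
    (phi : R -> clifford R n) (x : R) : clifford R n :=
  (Gamma (1 - k))^-1 *:
    cliff_integral `[x0, x]
      (fun t => (derive1 w t / (w x - w t) `^ k) *: phi t).

Lemma frac_int_base (R : realType) (n : nat) (x0 k : R) (w : R -> R)
  (phi : R -> clifford R n) : frac_int x0 k w phi x0 = 0.
Proof.
rewrite /frac_int /cliff_integral big1 ?scaler0 // => A _.
by rewrite set_itv1 Rintegral_set1 scale0r.
Qed.

(* (I_{a+}^{1-alpha,g} f)(u + I s) and (I_{0+}^{1-beta,h} f)(r + I v) *)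
Definition slice_int_u (R : realType) (n : nat) (a alpha : R) (g : R -> R)
    (f : clifford R n -> clifford R n) (I : clifford R n) (s u : R)
    : clifford R n :=
  frac_int a alpha g (fun t => f (slice_point I t s)) u.

Definition slice_int_v (R : realType) (n : nat) (beta : R) (h : R -> R)
    (f : clifford R n -> clifford R n) (I : clifford R n) (r v : R)
    : clifford R n :=
  frac_int 0 beta h (fun t => f (slice_point I r t)) v.

Definition RL_u (R : realType) (n : nat) (a b alpha : R) (g : R -> R)
    (f : clifford R n -> clifford R n) (I : clifford R n) (s u : R)
    : clifford R n :=
  (derive1 g u)^-1 *: derive_within `[a, b] (slice_int_u a alpha g f I s) u.

Definition RL_v (R : realType) (n : nat) (c beta : R) (h : R -> R)
    (f : clifford R n -> clifford R n) (I : clifford R n) (r v : R)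
    : clifford R n :=
  (derive1 h v)^-1 *: derive_within `[0, c] (slice_int_v beta h f I r) v.

Definition RL (R : realType) (n : nat) (a b c alpha beta : R) (g h : R -> R)
    (f : clifford R n -> clifford R n) (I : clifford R n) (r s u v : R)
    : clifford R n :=
  RL_u a b alpha g f I s u + I * RL_v c beta h f I r v.

(* H(f)(u + I v, r, s) for a function f on the slice domain *)
Definition calH (R : realType) (n : nat) (a alpha beta : R) (g h : R -> R)
    (f : clifford R n -> clifford R n) (I : clifford R n) (r s u v : R)
    : clifford R n :=
  slice_int_u a alpha g f I s u + slice_int_v beta h f I r v.

(* H[G](u, v) for a function G of two real variables *)
Definition calH2 (R : realType) (n : nat) (a alpha beta : R) (g h : R -> R)
    (G : R -> R -> clifford R n) (u v : R) : clifford R n :=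
  frac_int a alpha g (fun t => G t v) u + frac_int 0 beta h (fun t => G u t) v.

Definition caputo (R : realType) (n : nat) (a b c alpha beta : R)
    (g h : R -> R) (I : clifford R n) (G : R -> R -> clifford R n) (u v : R)
    : clifford R n :=
  frac_int a alpha g
    (fun t => (derive1 g t)^-1 *: derive_within `[a, b] (fun x => G x v) t) u +
  I * frac_int 0 beta h
    (fun t => (derive1 h t)^-1 *: derive_within `[0, c] (fun y => G u y) t) v.

(* Main.v *)
Require Import Defs.
From mathcomp Require Import all_boot all_order all_algebra.
From mathcomp Require Import all_classical all_reals all_analysis.
From mathcomp Require Import measurable_realfun.

(** The derivatives in the Caputo operator only see half of H(f) each: for
    fixed v the summand I_(0+)[f](r + I v) is a constant in u, and conversely.
    Hence d/du H(f) and d/dv H(f) are, after division by g' and h', exactly the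
    two Riemann-Liouville derivatives phi(u) and psi(v) of f, and the left-hand
    side is I_(a+)[phi](u) + I * I_(0+)[psi](v).

    On the right, H is applied to phi(u) + I psi(v).  Each fractional integral
    acts on one variable, for which one of the summands is a constant; pulling
    this constant out, and I as well, gives
      I_(a+)[phi + I psi(v)](u) = I_(a+)[phi](u) + I_(a+)[1](u) * (I psi(v)),
      I_(0+)[phi(u) + I psi](v) = I * I_(0+)[psi](v) + I_(0+)[1](v) * phi(u),
    (lemma calH2_separated).  The two terms carrying [1] are those that the
    statement subtracts.

    What has to be justified is the additivity of the fractional integrals and
    their commutation with multiplication by a Clifford number.  A Lebesgue
    integral is additive only on integrable functions, so the substance is that
    the singular kernel w'(t) / (w(x) - w(t))^k is integrable up to t = x for
    k < 1 (kernel_integrable).  A continuous factor is bounded on a segment and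
    preserves integrability; phi and psi are continuous because the fractional
    integrals of f are C^1 and g', h' are continuous and positive.  Commutation
    holds for every R-linear endomorphism L of the algebra (frac_int_linear),
    since the coordinates of L F are fixed combinations of those of F; left
    and right multiplications are instances. *)

Set Implicit Arguments.
Unset Strict Implicit.

Import Order.TTheory GRing.Theory Num.Theory.
Import numFieldNormedType.Exports.

Local Open Scope classical_set_scope.
Local Open Scope ring_scope.

(** * Integrability of the singular kernel *)

Definition class_C1 (R : realType) (w : R -> R) : Prop :=
  (forall t, derivable w t 1) /\ continuous (derive1 w).

Lemma ode_solution_C1 (R : realType) (l : R) (w : R -> R) :
  ode_solution l w -> class_C1 w.
Proof.
move=> [[dw ddw _] _]; split => // t.
by apply/differentiable_continuous/derivable1_diffP; exact: ddw.
Qed.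

Lemma kernel_primitive (R : realType) (k y t : R) (w : R -> R) :
  k < 1 -> derivable w t 1 -> w t < y ->
  is_derive t 1 (fun t => - (1 - k)^-1 * (y - w t) `^ (1 - k))
    (derive1 w t / (y - w t) `^ k).
Proof.
move=> k1 dw wty.
have ywt : 0 < y - w t by rewrite subr_gt0.
have dw' : is_derive t 1 w (derive1 w t) by rewrite derive1E; exact: derivableP.
have dpow : is_derive (y - w t) 1 (fun z => z `^ (1 - k))
    ((1 - k) * (y - w t) `^ (1 - k - 1)) by exact: is_derive1_powR.
have dsub : is_derive t 1 (fun t => y - w t) (0 - derive1 w t).
  exact: is_deriveB.
have dcomp := @is_derive1_comp R (fun z => z `^ (1 - k)) (fun t => y - w t)
  t _ _ dpow dsub.
have k0 : 1 - k != 0 by rewrite subr_eq0 gt_eqF.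
suff -> : derive1 w t / (y - w t) `^ k = - (1 - k)^-1 *:
    ((1 - k) * (y - w t) `^ (1 - k - 1) * (0 - derive1 w t)).
  exact: is_deriveZ.
rewrite addrAC subrr sub0r powRN sub0r mulrN.
by rewrite scaleNr scalerN opprK /GRing.scale /= !mulrA mulVf// mul1r mulrC.
Qed.

(** The primitive of kernel_primitive stays bounded as t tends to x, so the
    integrals over [x0, y] are bounded uniformly in y < x; as the kernel is
    nonnegative, exhausting [x0, x[ by such segments bounds the integral up to
    the singularity. *)
Lemma kernel_integrable (R : realType) (x0 x k : R) (w : R -> R) :
  k < 1 -> x0 <= x -> class_C1 w ->
  (forall t, t \in `[x0, x] -> 0 < derive1 w t) ->
  (@lebesgue_measure R).-integrable `[x0, x]
    (EFin \o (fun t => derive1 w t / (w x - w t) `^ k)).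
Proof.
move=> k1 x0x [dw cw'] w'0.
set K := (X in EFin \o X).
have cw : continuous w.
  by move=> t; apply/differentiable_continuous/derivable1_diffP; exact: dw.
have wlt t y : x0 <= t -> t < y -> y <= x -> w t < w y.
  move=> x0t ty yx; apply: (@gtr0_derive1_incr _ w x0 x) => //.
  - by move=> z /subset_itv_oo_cc zx; exact: w'0.
  - exact: continuous_subspaceT.
have mK : measurable_fun setT K.
  have -> : K = (fun t => derive1 w t * (w x - w t) `^ (- k)).
    by apply/funext => t; rewrite powRN.
  apply: measurable_funM; first exact: continuous_measurable_fun.
  apply: (measurableT_comp (@measurable_powR R (- k))).
  by apply: measurable_funB => //; exact: continuous_measurable_fun.
have K0 t : t \in `[x0, x] -> 0 <= K t.
  by move=> tx; rewrite /K divr_ge0// ?powR_ge0// ltW// w'0.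
have ubK y : y < x ->
    (\int[lebesgue_measure]_(t in `[x0, y]) (K t)%:E <=
      ((1 - k)^-1 * (w x - w x0) `^ (1 - k))%:E)%E.
  move=> yx; have k0 : 0 <= (1 - k)^-1 by rewrite invr_ge0 subr_ge0 ltW.
  (* The segments of the exhaustion below may end to the left of x0 or
     reduce to a point; they then carry no mass. *)
  have [x0y|yx0] := ltP x0 y; last first.
    rewrite (integral_Sset1 x0) ?lee_fin ?mulr_ge0 ?powR_ge0// => t /=.
    rewrite in_itv/= => /andP[x0t ty]; apply/eqP.
    by rewrite eq_le x0t (le_trans ty).
  have dP t : x0 <= t -> t <= y -> is_derive t 1
      (fun t => - (1 - k)^-1 * (w x - w t) `^ (1 - k)) (K t).
    move=> x0t ty; apply: kernel_primitive => //.
    by apply: wlt => //; exact: le_lt_trans yx.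
  have cP t : x0 <= t -> t <= y -> {for t, continuous
      (fun t => - (1 - k)^-1 * (w x - w t) `^ (1 - k))}.
    move=> x0t ty; apply/differentiable_continuous/derivable1_diffP.
    by case: (dP t x0t ty).
  rewrite (@continuous_FTC2 _ K
    (fun t => - (1 - k)^-1 * (w x - w t) `^ (1 - k)))//.
  - rewrite -EFinB lee_fin !mulNr opprK gerDr oppr_le0 mulr_ge0//.
    exact: powR_ge0.
  - apply: continuous_in_subspaceT => t; rewrite inE/= in_itv/=.
    move=> /andP[x0t ty]; have wtx : 0 < w x - w t.
      by rewrite subr_gt0 wlt// (le_lt_trans ty).
    apply: cvgM; first exact: cw'.
    apply: cvgV; first by rewrite powR_eq0 negb_and gt_eqF.
    have cpow : {for w x - w t, continuous (fun z : R => z `^ k)}.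
      apply/differentiable_continuous/derivable1_diffP.
      by have [] := is_derive1_powR k wtx.
    apply: (@continuous_comp _ _ _ (fun t => w x - w t) (fun z => z `^ k)) cpow.
    by apply: cvgB; [exact: cvg_cst|exact: cw].
  - split.
    + move=> t /subset_itv_oo_cc; rewrite in_itv/= => /andP[x0t ty].
      by case: (dP t x0t ty).
    + by apply: cvg_at_right_filter; apply: cP => //; exact: ltW.
    + by apply: cvg_at_left_filter; apply: cP => //; exact: ltW.
  - move=> t /subset_itv_oo_cc; rewrite in_itv/= => /andP[x0t ty].
    by rewrite derive1E; apply: (@derive_val _ _ _ _ _ _ _ (dP t x0t ty)).
apply/integrableP; split.
  by apply/measurable_EFinP; exact: measurable_funS mK.
have -> : (\int[lebesgue_measure]_(t in `[x0, x]) `|(EFin \o K) t| =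
           \int[lebesgue_measure]_(t in `[x0, x]) (K t)%:E)%E.
  apply: eq_integral => t; rewrite inE/= => tx.
  by rewrite ger0_norm// K0.
have mKE (D : set R) : measurable_fun D (EFin \o K).
  by apply/measurable_EFinP; exact: measurable_funS mK.
(* The end point x, where the primitive need not be differentiable, is
   negligible. *)
rewrite integral_itv_bndoo//.
rewrite -(@integral_itv_bndoo _ _ _ _ true true)//.
apply: (@le_lt_trans _ _ ((1 - k)^-1 * (w x - w x0) `^ (1 - k))%:E); last first.
  exact: ltry.
rewrite itv_bnd_open_bigcup.
pose F (n : nat) : set R := `[x0, x - n.+1%:R^-1]%classic.
have F_lt (n : nat) : x - n.+1%:R^-1 < x by rewrite ltrBlDr ltrDl invr_gt0.
have cvF : ((\int[@lebesgue_measure R]_(t in F n) (EFin \o K) t)%E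
    @[n --> \oo] --> \int[@lebesgue_measure R]_(t in \bigcup_n F n)
      (EFin \o K) t)%E.
  apply: ge0_nondecreasing_set_cvg_integral => //.
  - move=> m p mp; apply/subsetPset => t; rewrite /F /= !in_itv/=.
    move=> /andP[-> tm]; apply: (le_trans tm).
    by rewrite lerD2l lerN2 lef_pV2 ?posrE// ler_nat.
  - by move=> n; exact: measurable_itv.
  - by move=> n; exact: mKE.
  - move=> n t; rewrite /F /= in_itv/= => /andP[x0t tn].
    by rewrite lee_fin K0// in_itv/= x0t (le_trans tn)// ltW.
rewrite -(cvg_lim _ cvF)//; apply: lime_le; first exact: cvgP cvF.
by apply: nearW => n; exact: ubK.
Qed.

(** * Linearity of the integral of Clifford-valued functions *)

Definition cliff_integrable (R : realType) (n : nat) (D : set R)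
    (F : R -> clifford R n) : Prop :=
  forall A, (@lebesgue_measure R).-integrable D (EFin \o (coef A \o F)).

Lemma coef_cliff_integral (R : realType) (n : nat) (D : set R)
  (F : R -> clifford R n) (A : {set 'I_n}) :
  coef A (cliff_integral D F) =
  (\int[@lebesgue_measure R]_(t in D) coef A (F t)).
Proof.
rewrite /cliff_integral Defs.coef_sum (bigD1 A)//= big1 => [|B BA].
  by rewrite Defs.coefZ coef_blade eqxx mulr1 addr0.
by rewrite Defs.coefZ coef_blade eq_sym (negbTE BA) mulr0.
Qed.

Lemma cliff_integralD (R : realType) (n : nat) (D : set R)
  (F G : R -> clifford R n) : measurable D ->
  cliff_integrable D F -> cliff_integrable D G ->
  cliff_integral D (fun t => F t + G t) =
  cliff_integral D F + cliff_integral D G.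
Proof.
move=> mD iF iG; apply: coefP => A.
rewrite Defs.coefD !coef_cliff_integral.
under eq_Rintegral => t _ do rewrite Defs.coefD.
by rewrite RintegralD//; [exact: iF|exact: iG].
Qed.

(** Matrix form of an endomorphism in the basis of blades: this reduces the
    statements about L to finite linear combinations of real integrals. *)
Lemma coef_linear (R : realType) (n : nat)
  (L : {linear clifford R n -> clifford R n}) (A : {set 'I_n})
  (x : clifford R n) :
  coef A (L x) = \sum_(B : {set 'I_n}) coef A (L (blade R B)) * coef B x.
Proof.
rewrite [in LHS](clifford_decomp x) linear_sum Defs.coef_sum.
by apply: eq_bigr => B _; rewrite linearZ Defs.coefZ mulrC.
Qed.

Lemma cliff_integrable_linear (R : realType) (n : nat) (D : set R)
  (L : {linear clifford R n -> clifford R n}) (F : R -> clifford R n) :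
  measurable D -> cliff_integrable D F -> cliff_integrable D (L \o F).
Proof.
move=> mD iF A.
have -> : EFin \o (coef A \o (L \o F)) = (fun t => \sum_(B : {set 'I_n})
    (coef A (L (blade R B)))%:E * (EFin \o (coef B \o F)) t)%E.
  by apply/funext => t /=; rewrite coef_linear sumEFin.
by apply: integrable_sum => // B _; apply: integrableZl => //; exact: iF.
Qed.

Lemma cliff_integral_linear (R : realType) (n : nat) (D : set R)
  (L : {linear clifford R n -> clifford R n}) (F : R -> clifford R n) :
  measurable D -> cliff_integrable D F ->
  cliff_integral D (fun t => L (F t)) = L (cliff_integral D F).
Proof.
move=> mD iF; apply: coefP => A; rewrite coef_cliff_integral coef_linear.
under eq_Rintegral => t _ do rewrite coef_linear.
have -> : \sum_(B : {set 'I_n}) coef A (L (blade R B)) *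
      coef B (cliff_integral D F) =
    \sum_(B : {set 'I_n}) \int[@lebesgue_measure R]_(t in D)
      (coef A (L (blade R B)) * coef B (F t)).
  apply: eq_bigr => B _; rewrite coef_cliff_integral RintegralZl//.
  exact: iF.
have iB B : (@lebesgue_measure R).-integrable D
    (EFin \o (fun t => coef A (L (blade R B)) * coef B (F t))).
  have : (@lebesgue_measure R).-integrable D (fun t =>
      (coef A (L (blade R B)))%:E * (EFin \o (coef B \o F)) t)%E.
    by apply: integrableZl => //; exact: iF.
  exact.
rewrite /Rintegral; under eq_integral do rewrite -sumEFin.
rewrite integral_sum// -sum_fine// => B _.
by apply: integrable_fin_num => //; exact: iB.
Qed.

(** * Linearity of fractional integrals *)

(** Continuity of phi makes its coordinates measurable and, the segment being
    compact, bounded; an integrable kernel tolerates such factors. *)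
Lemma frac_integrand_integrable (R : realType) (n : nat) (x0 x k : R)
  (w : R -> R) (phi : R -> clifford R n) :
  (@lebesgue_measure R).-integrable `[x0, x]
    (EFin \o (fun t => derive1 w t / (w x - w t) `^ k)) ->
  {within `[x0, x], continuous phi} ->
  cliff_integrable `[x0, x]
    (fun t => (derive1 w t / (w x - w t) `^ k) *: phi t).
Proof.
move=> iK cphi A.
have cA : {within `[x0, x], continuous (coef A \o phi)}.
  move=> t; apply: (@continuous_comp (subspace `[x0, x]) (clifford R n) R
    phi (coef A) t (cphi t)).
  exact: coord_continuous.
have -> : EFin \o (coef A \o
      (fun t => (derive1 w t / (w x - w t) `^ k) *: phi t)) =
    ((EFin \o (fun t => derive1 w t / (w x - w t) `^ k)%R) \*
      (EFin \o (coef A \o phi)))%E.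
  by apply/funext => t /=; rewrite Defs.coefZ EFinM.
apply: integrableMl => //.
  exact: subspace_continuous_measurable_fun.
have := compact_bounded (continuous_compact cA (@segment_compact _ _ _)).
case=> M [Mr MP]; exists M; split => // y My t tx.
by apply: MP => //; exists t.
Qed.

(** Linearity is stated under this condition rather than under continuity of
    phi because it visibly passes to L \o phi for every endomorphism L: the
    integrand for L \o phi is the image by L of the integrand for phi. *)
Definition frac_integrable (R : realType) (n : nat) (x0 k : R) (w : R -> R)
    (phi : R -> clifford R n) (x : R) : Prop :=
  cliff_integrable `[x0, x]
    (fun t => (derive1 w t / (w x - w t) `^ k) *: phi t).

Lemma continuous_frac_integrable (R : realType) (n : nat) (x0 x k : R)
  (w : R -> R) (phi : R -> clifford R n) :
  k < 1 -> x0 <= x -> class_C1 w ->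
  (forall t, t \in `[x0, x] -> 0 < derive1 w t) ->
  {within `[x0, x], continuous phi} -> frac_integrable x0 k w phi x.
Proof.
move=> k1 x0x C1w w0 cphi.
exact: frac_integrand_integrable (kernel_integrable k1 x0x C1w w0) cphi.
Qed.

Lemma frac_integrable_linear (R : realType) (n : nat) (x0 x k : R) (w : R -> R)
  (L : {linear clifford R n -> clifford R n}) (phi : R -> clifford R n) :
  frac_integrable x0 k w phi x -> frac_integrable x0 k w (L \o phi) x.
Proof.
move=> iphi; rewrite /frac_integrable.
have -> : (fun t => (derive1 w t / (w x - w t) `^ k) *: (L \o phi) t) =
    L \o (fun t => (derive1 w t / (w x - w t) `^ k) *: phi t).
  by apply/funext => t /=; rewrite linearZ.
exact: cliff_integrable_linear.
Qed.

Lemma frac_int_linear (R : realType) (n : nat) (x0 x k : R) (w : R -> R)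
  (L : {linear clifford R n -> clifford R n}) (phi : R -> clifford R n) :
  frac_integrable x0 k w phi x ->
  frac_int x0 k w (L \o phi) x = L (frac_int x0 k w phi x).
Proof.
move=> iphi; rewrite /frac_int linearZ; congr (_ *: _).
rewrite -cliff_integral_linear//.
by congr cliff_integral; apply/funext => t; rewrite linearZ.
Qed.

Lemma frac_intD (R : realType) (n : nat) (x0 x k : R) (w : R -> R)
  (phi psi : R -> clifford R n) :
  frac_integrable x0 k w phi x -> frac_integrable x0 k w psi x ->
  frac_int x0 k w (fun t => phi t + psi t) x =
  frac_int x0 k w phi x + frac_int x0 k w psi x.
Proof.
move=> iphi ipsi; rewrite /frac_int -scalerDr; congr (_ *: _).
rewrite -cliff_integralD//.
by congr cliff_integral; apply/funext => t; rewrite scalerDr.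
Qed.

(** * Derivatives and continuity within a set *)

Lemma derive_withinDr (R : realType) (V : normedModType R) (D : set R)
  (F : R -> V) (z : V) :
  derive_within D (fun t => F t + z) = derive_within D F.
Proof.
have dqE : diff_quot (fun t => F t + z) = diff_quot F.
  apply/funext => x; apply/funext => t.
  by rewrite /diff_quot opprD addrACA subrr addr0.
by rewrite /derive_within dqE.
Qed.

Lemma derive_withinDl (R : realType) (V : normedModType R) (D : set R)
  (F : R -> V) (z : V) :
  derive_within D (fun t => z + F t) = derive_within D F.
Proof.
by rewrite -(derive_withinDr D F z); congr derive_within; apply/funext => t;
  rewrite addrC.
Qed.

Lemma within_continuousZV (R : realType) (V : normedModType R) (D : set R)
  (p : R -> R) (F : R -> V) :
  (forall t, D t -> p t != 0) -> continuous p -> {within D, continuous F} ->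
  {within D, continuous (fun t => (p t)^-1 *: F t)}.
Proof.
move=> p0 cp /subspace_continuousP cF; apply/subspace_continuousP => t Dt.
apply: cvgZ; last exact: cF.
apply: cvgV; first exact: p0.
by apply: (@cvg_within_filter _ _ p _ _ _ D); exact: cp.
Qed.

(** * Fractional integrals of sums in separated variables *)

(** The constant z is written 1 * z, the image of the constant function 1 by
    right multiplication by z, so that both terms are covered by
    frac_int_linear. *)
Lemma frac_int_affine (R : realType) (n : nat) (x0 x1 x k : R) (w : R -> R)
  (phi : R -> clifford R n) (y z : clifford R n) :
  k < 1 -> class_C1 w ->
  (forall t, t \in `[x0, x1] -> 0 < derive1 w t) ->
  x \in `[x0, x1] -> {within `[x0, x1], continuous phi} ->
  frac_int x0 k w (fun t => y * phi t + z) x =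
  y * frac_int x0 k w phi x + frac_int x0 k w (fun=> 1) x * z.
Proof.
move=> k1 C1w w0; rewrite in_itv/= => /andP[x0x xx1] cphi.
have sub : `[x0, x] `<=` `[x0, x1] by apply: subset_itvl; rewrite bnd_simp.
have int_cont chi : {within `[x0, x], continuous chi} ->
    frac_integrable x0 k w chi x.
  move=> cchi; apply: (continuous_frac_integrable k1 x0x C1w) => // t tx.
  by apply: w0; exact: sub.
have iphi : frac_integrable x0 k w phi x.
  exact/int_cont/(continuous_subspaceW sub).
have i1 : frac_integrable x0 k w (fun=> 1 : clifford R n) x.
  by apply: int_cont => t; exact: cvg_cst.
have zE : (fun=> z) = (z \o* idfun) \o (fun=> 1) :> (R -> clifford R n).
  by apply/funext => t /=; rewrite mul1r.
rewrite (@frac_intD _ _ _ _ _ _ (fun t => y * phi t) (fun=> z)) ?zE.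
- congr (_ + _).
  + exact: (@frac_int_linear _ _ _ _ _ _ (y \*o idfun)).
  + exact: (@frac_int_linear _ _ _ _ _ _ (z \o* idfun)).
- exact: (@frac_integrable_linear _ _ _ _ _ _ (y \*o idfun)).
- exact: (@frac_integrable_linear _ _ _ _ _ _ (z \o* idfun)).
Qed.

(** Each of the two fractional integrals sees one summand as a function and the
    other as a constant. *)
Lemma calH2_separated (R : realType) (n : nat) (a b c alpha beta u v : R)
  (g h : R -> R) (phi psi : R -> clifford R n) (z : clifford R n) :
  alpha < 1 -> beta < 1 -> class_C1 g -> class_C1 h ->
  (forall t, t \in `[a, b] -> 0 < derive1 g t) ->
  (forall t, t \in `[0, c] -> 0 < derive1 h t) ->
  {within `[a, b], continuous phi} -> {within `[0, c], continuous psi} ->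
  u \in `[a, b] -> v \in `[0, c] ->
  calH2 a alpha beta g h (fun t y => phi t + z * psi y) u v =
  (frac_int a alpha g phi u + z * frac_int 0 beta h psi v) +
  (frac_int a alpha g (fun=> 1) u * (z * psi v) +
   frac_int 0 beta h (fun=> 1) v * phi u).
Proof.
move=> a1 b1 C1g C1h g0 h0 cphi cpsi uab v0c; rewrite /calH2.
(* frac_int_affine is used with y = 1 for g and y = z for h. *)
have phiE : (fun t => phi t + z * psi v) = (fun t => 1 * phi t + z * psi v).
  by apply/funext => t; rewrite (mul1r (phi t)).
have psiE : (fun y => phi u + z * psi y) = (fun y => z * psi y + phi u).
  by apply/funext => y; rewrite addrC.
rewrite phiE psiE (frac_int_affine _ _ a1 C1g g0 uab cphi).
rewrite (frac_int_affine _ _ b1 C1h h0 v0c cpsi).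
by rewrite (mul1r (frac_int _ _ _ _ _)) [LHS]addrACA.
Qed.

Unset Implicit Arguments.

(** * The Caputo operator applied to H(f) *)

Theorem proposition13 (R : realType) (n : nat) (a b c alpha beta r s lambda : R)
  (g h : R -> R) (f : clifford R n -> clifford R n)
  (hab : a < b) (hc : 0 < c)
  (halpha : 0 < alpha < 1) (hbeta : 0 < beta < 1)
  (hr : r \in `[a, b]) (hs : s \in `[0, c])
  (hg : ode_solution lambda g) (hh : ode_solution lambda h)
  (hg' : forall u, u \in `[a, b] -> 0 < derive1 g u)
  (hh' : forall v, v \in `[0, c] -> 0 < derive1 h v)
  (hf : AC1 a b c r s f)
  (hfu : forall I, sphere R n I ->
     class_C1_within `[a, b] (slice_int_u a alpha g f I s))
  (hfv : forall I, sphere R n I ->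
     class_C1_within `[0, c] (slice_int_v beta h f I r)) :
  forall (I : clifford R n) (u v : R),
    sphere R n I -> u \in `[a, b] -> v \in `[0, c] ->
    caputo a b c alpha beta g h I (calH a alpha beta g h f I r s) u v =
    calH2 a alpha beta g h (RL a b c alpha beta g h f I r s) u v
    - frac_int 0 beta h (fun=> 1) v * RL_u a b alpha g f I s u
    - frac_int a alpha g (fun=> 1) u * I * RL_v c beta h f I r v.
Proof.
move=> I u v SI uab v0c.
have [_ cu] := hfu I SI; have [_ cv] := hfv I SI.
have [/andP[_ a1] /andP[_ b1]] := (halpha, hbeta).
have C1g := ode_solution_C1 hg; have C1h := ode_solution_C1 hh.
have cRLu : {within `[a, b], continuous (RL_u a b alpha g f I s)}.
  by apply: within_continuousZV (proj2 C1g) cu => t /hg' /lt0r_neq0.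
have cRLv : {within `[0, c], continuous (RL_v c beta h f I r)}.
  by apply: within_continuousZV (proj2 C1h) cv => t /hh' /lt0r_neq0.
have caputoE : caputo a b c alpha beta g h I
    (calH a alpha beta g h f I r s) u v =
    frac_int a alpha g (RL_u a b alpha g f I s) u +
    I * frac_int 0 beta h (RL_v c beta h f I r) v.
  by rewrite /caputo /calH derive_withinDr derive_withinDl.
rewrite caputoE.
rewrite (calH2_separated I a1 b1 C1g C1h hg' hh' cRLu cRLv uab v0c) -mulrA.
have cancelK (p q t : clifford R n) : p + (q + t) - t - q = p.
  by rewrite addrA !addrK.
exact/esym/cancelK.
Qed.
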